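(* Let $f$ be a function of $m$ sets given by a union-intersection expression (a rooted binary tree whose leaves are the $m$ input sets and whose internal nodes are $\cup$ or $\cap$) such that every root-to-leaf path contains an intersection node. Let $n$ and $k$ be integers with $k\le n/m$. Then any (possibly randomized) algorithm in the cell probe model with word size $w$ that takes representations of sets $S_1,\dots,S_m\subseteq\{0,1\}^w$, where $\sum_i|S_i|\le n$ and $|f(S_1,\dots,S_m)|\le k$, and computes $|f(S_1,\dots,S_m)|$, must use expected time at least $\Omega\big(n/(w\, m\log m) + (1-\tfrac{\log k}{w})k\big)$ on a worst-case input. This holds regardless of how each set $S_i$ is (individually) represented.
   Context: In the cell probe model, time is measured as the number of $w$-bit memory cells accessed; each set $S_i$ is preprocessed into its representation independently of the other sets, in an arbitrary (possibly randomized) way.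
   Formalization: Assumes w ≥ 1, k ≥ 1 and n ≤ m·2^w (for fixed w, m and n → ∞ the bound is false, since all inputs fit in boundedly many cells; for k = 0 log k is undefined and the answer is trivially 0); ''computes'' means correct with probability 1. *)

(* Defs.v *)
From HB Require Import structures.
From mathcomp Require Import all_boot all_order all_algebra.
From mathcomp Require Import all_classical all_reals all_analysis.
From mathcomp Require Import measurable_realfun.

Set Implicit Arguments.
Unset Strict Implicit.
Unset Printing Implicit Defensive.

Import Order.TTheory GRing.Theory Num.Theory.
Import numFieldNormedType.Exports.
Local Open Scope ring_scope.

(* {0,1}^w: both the universe of set elements and the contents of a cell. *)
Definition word (w : nat) : finType := w.-tuple bool.

Variant set_op := Union | Inter.

Definition is_inter (o : set_op) : bool := if o is Inter then true else false.

Inductive ui_tree (m : nat) :=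
  | Leaf of 'I_m
  | Node of set_op & ui_tree m & ui_tree m.

Fixpoint leaves (m : nat) (e : ui_tree m) : seq 'I_m :=
  match e with
  | Leaf i => [:: i]
  | Node _ l r => leaves l ++ leaves r
  end.

(* The leaves are exactly the m input sets, each occurring once. *)
Definition ui_expression (m : nat) (e : ui_tree m) : bool :=
  perm_eq (leaves e) (enum 'I_m).

(* The sequences of internal-node labels met on the root-to-leaf paths. *)
Fixpoint root_leaf_paths (m : nat) (e : ui_tree m) : seq (seq set_op) :=
  match e with
  | Leaf _ => [:: [::]]
  | Node o l r => [seq o :: p | p <- root_leaf_paths l ++ root_leaf_paths r]
  end.

Definition inter_on_every_path (m : nat) (e : ui_tree m) : bool :=
  all (has is_inter) (root_leaf_paths e).

Fixpoint ui_eval (U : finType) (m : nat) (S : 'I_m -> {set U})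
    (e : ui_tree m) : {set U} :=
  match e with
  | Leaf i => S i
  | Node Union l r => ui_eval S l :|: ui_eval S r
  | Node Inter l r => ui_eval S l :&: ui_eval S r
  end.

Definition admissible (w m : nat) (e : ui_tree m) (n k : nat)
    (S : 'I_m -> {set word w}) : Prop :=
  (\sum_i #|S i| <= n)%N /\ (#|ui_eval S e| <= k)%N.

(* Probe i a reads cell a of the representation of the i-th set. *)
Variant action (m : nat) :=
  | Probe of 'I_m & nat
  | Answer of nat.

Definition is_probe (m : nat) (a : action m) : bool :=
  if a is Probe _ _ then true else false.

(* The representation of the i-th set is a memory nat -> word w that depends
   on that set only; the next action of the query algorithm is an arbitrary
   function of the contents of the cells read so far, since only cell accesses
   are charged. *)
Record scheme (w m : nat) := Scheme {
  represent : 'I_m -> {set word w} -> nat -> word w;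
  query : seq (word w) -> action m
}.

(* The contents read during the first t steps. *)
Fixpoint history (w m : nat) (A : scheme w m) (S : 'I_m -> {set word w})
    (t : nat) : seq (word w) :=
  if t is t'.+1 then
    let h := history A S t' in
    match query A h with
    | Probe i a => rcons h (represent A i (S i) a)
    | Answer _ => h
    end
  else [::].

Definition outputs (w m : nat) (A : scheme w m) (S : 'I_m -> {set word w})
    (y : nat) : Prop :=
  exists t, query A (history A S t) = Answer m y.

(* The number of probes, +oo when the algorithm never answers. *)
Definition probes (R : realType) (w m : nat) (A : scheme w m)
    (S : 'I_m -> {set word w}) : \bar R :=
  (\sum_(0 <= t <oo) ((is_probe (query A (history A S t)))%:R)%:E)%E.

(* A randomized algorithm is a family of schemes indexed by a probability
   space that carries the randomness of all the representations and of the
   query algorithm, possibly shared between them.  Answers are correct almost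
   surely; only the number of probes is averaged. *)
Definition computes_card (R : realType) (d : measure_display)
    (T : measurableType d) (P : probability T R) (w m : nat)
    (A : T -> scheme w m) (e : ui_tree m) (n k : nat) : Prop :=
  forall S : 'I_m -> {set word w}, admissible e n k S ->
    measurable_fun [set: T]%classic (fun x => probes R (A x) S) /\
    {ae P, forall x, outputs (A x) S #|ui_eval S e|}.

Definition expected_time (R : realType) (d : measure_display)
    (T : measurableType d) (P : probability T R) (w m : nat)
    (A : T -> scheme w m) (S : 'I_m -> {set word w}) : \bar R :=
  (\int[P]_x probes R (A x) S)%E.

Definition log2 (R : realType) (x : R) : R := ln x / ln 2.

(* Main.v *)
(* Since answers are almost surely correct, almost every outcome of the
   randomness is a deterministic zero-error scheme, and only the number of
   probes has to be averaged over a hard distribution of inputs.  Colour the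
   leaves with two sets a and b so that f = a :&: b.  The inputs (a, b) reaching
   a given answer form a rectangle; if each such rectangle holds at most L of
   the inputs X, Kraft's inequality and convexity give an average of at least
   log2(#|X| / L) / w probes on X.  The two terms of the bound come from
   - the 3^N disjoint pairs of subsets of a set of N = n %/ m words, of which a
     rectangle without uniquely intersecting pairs holds at most 2^N;
   - the fooling set of the pairs (a, a) with #|a| = k, with L = 1.
   Two sets already give N / w without the factor log m. *)
Require Import Defs.
From HB Require Import structures.
From mathcomp Require Import all_boot all_order all_algebra.
From mathcomp Require Import all_classical all_reals all_analysis.
From mathcomp Require Import measurable_realfun.
From mathcomp Require Import fintype finset ring lra.
Set Implicit Arguments.
Unset Strict Implicit.
Unset Printing Implicit Defensive.
Import Order.TTheory GRing.Theory Num.Theory.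
Import numFieldNormedType.Exports.
Local Open Scope ring_scope.

(** * Counting disjoint pairs of sets *)

Definition disjoint_pairs (U : finType) : {set {set U} * {set U}} :=
  [set p : {set U} * {set U} | [disjoint p.1 & p.2]].

(* Induction on V (Kaibel and Weltge): removing v from V, the number of
   disjoint pairs in P x Q is at most the sum of those in (P0 u P1) x Q0 and
   P0 x (Q0 u Q1), where P0 is the part of P without v and P1 the part with v,
   deprived of it.  Indeed a disjoint pair in P0 x Q0 counts twice on the right,
   and it cannot lie in P1 x Q1, else adding v would give a pair that meets in
   exactly one point. *)
Lemma card_disjoint_pairs_le (U : finType) (V : {set U}) (P Q : {set {set U}}) :
    (forall a, a \in P -> a \subset V) -> (forall b, b \in Q -> b \subset V) ->
    (forall a b, a \in P -> b \in Q -> #|a :&: b| != 1%N) ->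
  (#|disjoint_pairs U :&: setX P Q| <= 2 ^ #|V|)%N.
Proof.
have [n] := ubnP #|V|; elim: n => // n IHn in V P Q *.
rewrite ltnS => leVn PV QV PQ1.
have [V0|[v vV]] := set_0Vmem V.
  rewrite V0 cards0 expn0 -(cards1 (set0 : {set U}, set0 : {set U})).
  apply: subset_leq_card; apply/subsetP => -[a b]; rewrite !inE /=.
  case/and3P => _ /PV + /QV; rewrite V0 !subset0 => /eqP -> /eqP ->.
  by rewrite eqxx.
pose P0 := [set a in P | v \notin a].
pose P1 := [set a : {set U} | (v \notin a) && (v |: a \in P)].
pose Q0 := [set b in Q | v \notin b].
pose Q1 := [set b : {set U} | (v \notin b) && (v |: b \in Q)].
have D1id (c : {set U}) : v \notin c -> c :\ v = c.
  by move=> vc; apply/setDidPl; rewrite disjoint_sym disjoints1.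
have cV : #|V :\ v|.+1 = #|V| by rewrite (cardsD1 v V) vV.
have sub0 (P' : {set {set U}}) : (forall a, a \in P' -> a \subset V) ->
    forall a, a \in [set a in P' | v \notin a] -> a \subset V :\ v.
  by move=> P'V a; rewrite inE subsetD1 => /andP[/P'V -> ->].
have sub1 (P' : {set {set U}}) : (forall a, a \in P' -> a \subset V) ->
    forall a, a \in [set a : {set U} | (v \notin a) && (v |: a \in P')] ->
    a \subset V :\ v.
  move=> P'V a; rewrite inE subsetD1 => /andP[-> /P'V].
  by rewrite subUset => /andP[_ ->].
have IH1 : (#|disjoint_pairs U :&: setX (P0 :|: P1) Q0| <= 2 ^ #|V :\ v|)%N.
  apply: IHn; first by rewrite cV.
  - by move=> a; rewrite inE => /orP[|]; [exact: sub0|exact: sub1].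
  - exact: sub0.
  - move=> a b; rewrite !inE => aP /andP[bQ vb].
    case/orP: aP => /andP[]; first by move=> aP _; exact: PQ1.
    move=> va aP; have := PQ1 _ _ aP bQ.
    by rewrite setIUl (_ : [set v] :&: b = set0) ?set0U//; apply/eqP;
      rewrite setI_eq0 disjoints1.
have IH2 : (#|disjoint_pairs U :&: setX P0 (Q0 :|: Q1)| <= 2 ^ #|V :\ v|)%N.
  apply: IHn; first by rewrite cV.
  - exact: sub0.
  - by move=> b; rewrite inE => /orP[|]; [exact: sub0|exact: sub1].
  - move=> a b; rewrite !inE => /andP[aP va] bQ.
    case/orP: bQ => /andP[]; first by move=> bQ _; exact: PQ1.
    move=> vb bQ; have := PQ1 _ _ aP bQ.
    by rewrite setIUr (_ : a :&: [set v] = set0) ?set0U//; apply/eqP;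
      rewrite setI_eq0 disjoint_sym disjoints1.
have P1Q1 a b : a \in P1 -> b \in Q1 -> ~~ [disjoint a & b].
  rewrite !inE => /andP[va aP] /andP[vb bQ]; have := PQ1 _ _ aP bQ.
  by apply: contraNN; rewrite -setUIr -setI_eq0 => /eqP ->; rewrite setU0 cards1.
rewrite -cV expnS mul2n -addnn.
set D := _ :&: _.
(* [E] is chosen so that deleting [v] from the first set is injective on it: a set without [v] is
   kept only if it is not in [P1]. On the rest of [D], [v] lies outside the first set and, by
   [P1Q1], deleting [v] from the second set is injective. *)
pose E := [set p in D | (v \notin p.2) && ((v \in p.1) || (p.1 \notin P1))].
rewrite -(cardsID E D); apply: leq_add.
- apply: leq_trans IH1.
  pose f (p : {set U} * {set U}) := (p.1 :\ v, p.2).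
  rewrite -(@card_in_imset _ _ f).
    apply: subset_leq_card; apply/subsetP => _ /imsetP[[a b] + ->].
    rewrite !inE /=; case: (v \in b) => /=; first by rewrite !andbF.
    rewrite !andbT => /andP[/and3P[dab aP bQ] /andP[_ aE]].
    rewrite (disjointWl _ dab) ?subsetDl// bQ eqxx /= !andbT.
    case va: (v \in a); first by rewrite setD1K// aP orbT.
    by rewrite D1id ?va// aP.
  move=> [a b] [a' b'] /=; rewrite !inE /=.
  move=> /andP[_ /andP[/and3P[_ aP bQ] /andP[vb aE]]].
  move=> /andP[_ /andP[/and3P[_ aP' bQ'] /andP[vb' aE']]].
  case=> eqa eqb; congr pair => //.
  case va: (v \in a) aE => aE; case va': (v \in a') aE' => aE'.
  + by rewrite -(setD1K va) eqa setD1K.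
  + by move: aE'; rewrite -(D1id a') ?va'// -eqa setD1K// aP.
  + by move: aE; rewrite -(D1id a) ?va// eqa setD1K// aP'.
  + by rewrite -(D1id a) ?va// eqa D1id ?va'.
- apply: leq_trans IH2.
  pose f (p : {set U} * {set U}) := (p.1, p.2 :\ v).
  have DE a b : (a, b) \in D :\: E -> [/\ [disjoint a & b], a \in P, b \in Q,
      v \notin a & v \notin b -> b \notin Q1].
    rewrite in_setD [_ \in E]inE andbC => /andP[abD]; rewrite abD /=.
    move: abD; rewrite inE in_setX inE /= => /and3P[dab aP bQ].
    rewrite negb_and negbK negb_or negbK => /orP[vb|/andP[va aP1]].
      split=> //; last by rewrite vb.
      by apply/negP => va; move/pred0P: dab => /(_ v) /=; rewrite va vb.
    split=> // _; apply/negP => bQ1.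
    by have := P1Q1 _ _ aP1 bQ1; rewrite dab.
  rewrite -(@card_in_imset _ _ f).
    apply: subset_leq_card; apply/subsetP => _ /imsetP[[a b] /DE + ->].
    case=> dab aP bQ va bE.
    rewrite !inE /= aP va (disjointWr _ dab) ?subsetDl//= eqxx /= andbT.
    case vb: (v \in b); first by rewrite setD1K// bQ orbT.
    by rewrite D1id ?vb// bQ.
  move=> [a b] [a' b'] /= /DE[_ aP bQ va bE] /DE[_ aP' bQ' va' bE'].
  case=> eqa eqb; congr pair => //.
  case vb: (v \in b) bE => bE; case vb': (v \in b') bE' => bE'.
  + by rewrite -(setD1K vb) eqb setD1K.
  + by move: (bE' isT); rewrite -(D1id b') ?vb'// -eqb inE setD11 setD1K// bQ.
  + by move: (bE isT); rewrite -(D1id b) ?vb// eqb inE setD11 setD1K// bQ'.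
  + by rewrite -(D1id b) ?vb// eqb D1id ?vb'.
Qed.

(** A disjoint pair in [V] is a map from [V] to three values: [Some true] for the first set,
    [Some false] for the second, [None] for neither. *)
Lemma card_disjoint_pairs_powerset (U : finType) (V : {set U}) :
  (3 ^ #|V| <= #|disjoint_pairs U :&: setX (powerset V) (powerset V)|)%N.
Proof.
have <- : #|pffun_on (None : option bool) (mem V) predT| = (3 ^ #|V|)%N.
  by rewrite card_pffun_on card_option card_bool.
pose f (g : {ffun U -> option bool}) :=
  ([set x | g x == Some true], [set x | g x == Some false]).
have f_inj : injective f.
  move=> g g' [/setP eqt /setP eqf]; apply/ffunP => x.
  by have := eqt x; have := eqf x; rewrite !inE;
    case: (g x) => [[]|]; case: (g' x) => [[]|].
rewrite -(card_imset _ f_inj).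
apply: subset_leq_card; apply/subsetP => _ /imsetP[g /pffun_onP[gV _] ->].
rewrite !inE /=; apply/and3P; split.
- by rewrite -setI_eq0; apply/eqP/setP => x; rewrite !inE; case: (g x) => [[]|].
- apply/subsetP => x; rewrite inE => /eqP gx; apply: (subsetP gV).
  by rewrite inE gx.
- apply/subsetP => x; rewrite inE => /eqP gx; apply: (subsetP gV).
  by rewrite inE gx.
Qed.

(** A fixed ratio [q] in place of n/k lets the induction lower [n] and [k] together; 1 <= q
    preserves the hypothesis for the smaller pair. *)
Lemma expr_le_bin (R : realFieldType) (q : R) (n k : nat) :
  1 <= q -> q * k%:R <= n%:R -> q ^+ k <= 'C(n, k)%:R.
Proof.
move=> q1; elim: k n => [|k IHk] [|n] qk; rewrite ?bin0 ?expr0//.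
  have : 0 < q * k.+1%:R by rewrite mulr_gt0 ?ltr0n// (lt_le_trans ltr01).
  by rewrite ltNge qk.
have IH : q ^+ k <= 'C(n, k)%:R.
  by apply: IHk; move: qk; rewrite -!natr1 mulrDr mulr1; lra.
have : n.+1%:R * 'C(n, k)%:R = k.+1%:R * 'C(n.+1, k.+1)%:R :> R.
  by rewrite -!natrM (mul_bin_diag n.+1 k).
move=> E; rewrite -(@ler_pM2l _ k.+1%:R) ?ltr0n// -E exprS mulrA (mulrC _ q).
by rewrite ler_pM// ?mulr_ge0 ?exprn_ge0// (le_trans ler01).
Qed.

(** * Reduction of the expression to two sets *)

Lemma ui_eval_ext (U : finType) (m : nat) (S S' : 'I_m -> {set U})
    (e : ui_tree m) :
  (forall i, i \in leaves e -> S i = S' i) -> ui_eval S e = ui_eval S' e.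
Proof.
elim: e => [i|o l IHl r IHr] /= SS'; first by rewrite SS' ?inE.
by rewrite IHl ?IHr// => i ie; rewrite SS'// mem_cat ie ?orbT.
Qed.

Lemma ui_eval_const (U : finType) (m : nat) (a : {set U}) (e : ui_tree m) :
  ui_eval (fun=> a) e = a.
Proof. by elim: e => //= -[] l -> r ->; rewrite ?setUid ?setIid. Qed.

Definition two_sets (m : nat) (c : 'I_m -> bool) (U : finType) (a b : {set U})
  (i : 'I_m) : {set U} := if c i then a else b.

(* Below a topmost intersection node, the left subtree gets the first set and
   the right one the second. *)
Lemma two_coloring (m : nat) (e : ui_tree m) :
    uniq (leaves e) -> inter_on_every_path e ->
  exists c : 'I_m -> bool, forall (U : finType) (a b : {set U}),
    ui_eval (two_sets c a b) e = a :&: b.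
Proof.
elim: e => [i|[] l IHl r IHr] //=; rewrite cat_uniq => /and3P[ul lr ur].
- rewrite /inter_on_every_path /= all_map all_cat => /andP[pl pr].
  have lrF i : i \in leaves r -> (i \in leaves l) = false.
    by move=> ir; apply: contraNF lr => il; apply/hasP; exists i.
  have [cl Hl] := IHl ul pl; have [cr Hr] := IHr ur pr.
  exists (fun i => if i \in leaves l then cl i else cr i) => U a b /=.
  rewrite -[RHS]setUid -{1}Hl -Hr; congr (_ :|: _); apply: ui_eval_ext => i ie.
    by rewrite /two_sets ie.
  by rewrite /two_sets lrF.
- move=> _; exists (fun i => i \in leaves l) => U a b /=.
  rewrite -[a in RHS](ui_eval_const _ l) -[b in RHS](ui_eval_const _ r).
  congr (_ :&: _); apply: ui_eval_ext => i; rewrite /two_sets; first by move=> ->.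
  move=> ir; rewrite ifN//.
  by apply: contraNN lr => il; apply/hasP; exists i.
Qed.

(** * Runs of a scheme *)

(** An iteration can be restarted from any history, as the induction of [rectangle_kraft]
    requires. *)
Lemma history_iter (w m : nat) (A : scheme w m) (S : 'I_m -> {set word w}) t :
  history A S t = iter t (fun h => if query A h is Probe i a
    then rcons h (represent A i (S i) a) else h) [::].
Proof. by elim: t => //= t <-; case: (query _ _). Qed.

Lemma history_answer (w m : nat) (A : scheme w m) (S : 'I_m -> {set word w})
    t t' y :
  (t <= t')%N -> query A (history A S t) = Answer m y ->
  history A S t' = history A S t.
Proof.
by move=> /subnK <- Ht; elim: (t' - t)%N => //= s ->; rewrite Ht.
Qed.

Lemma size_history (w m : nat) (A : scheme w m) (S : 'I_m -> {set word w}) t :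
  size (history A S t) =
  (\sum_(0 <= s < t) is_probe (query A (history A S s)))%N.
Proof.
elim: t => [|t IHt]; first by rewrite big_geq.
rewrite big_nat_recr//= -IHt; case: (query _ _) => [i a|y] /=.
  by rewrite size_rcons addn1.
by rewrite addn0.
Qed.

Lemma outputs_uniq (w m : nat) (A : scheme w m) (S : 'I_m -> {set word w}) y z :
  outputs A S y -> outputs A S z -> y = z.
Proof.
move=> [t Ht] [s Hs]; case: (leqP t s) => [ts|/ltnW st].
  by move: Hs; rewrite (history_answer ts Ht) Ht => -[].
by move: Ht; rewrite (history_answer st Hs) Hs => -[].
Qed.

Lemma probes_ge_size (R : realType) (w m : nat) (A : scheme w m)
    (S : 'I_m -> {set word w}) t :
  ((size (history A S t))%:R%:E <= probes R A S)%E.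
Proof.
rewrite size_history natr_sum -sumEFin /probes.
by apply: nneseries_lim_ge => i _ _; rewrite lee_fin.
Qed.

Lemma probes_ge0 (R : realType) (w m : nat) (A : scheme w m)
    (S : 'I_m -> {set word w}) : (0 <= probes R A S)%E.
Proof. exact: le_trans (probes_ge_size R A S 0). Qed.

(** * Average number of probes of a deterministic scheme *)

Section Rectangles.
Variables (w m : nat) (c : 'I_m -> bool) (A : scheme w m).
Variables (F : {set {set word w}}) (X : {set {set word w} * {set word w}}).
Variable L : nat.

Let hist (p : {set word w} * {set word w}) t :=
  history A (two_sets c p.1 p.2) t.

Let step (p : {set word w} * {set word w}) h :=
  if query A h is Probe i a
  then rcons h (represent A i (two_sets c p.1 p.2 i) a) else h.

(** The answer is constrained on the whole rectangle, also outside [X]: correctness there is what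
    keeps rectangles small. *)
Hypothesis rectangle_le : forall (P Q : {set {set word w}}) y,
  P \subset F -> Q \subset F ->
  (forall p, p \in setX P Q -> outputs A (two_sets c p.1 p.2) y) ->
  (#|X :&: setX P Q| <= L)%N.

(* Kraft's inequality: the inputs that reach a given history form a rectangle,
   which a probe splits into at most 2^w rectangles. *)
Lemma rectangle_kraft (R : realFieldType) T (P Q : {set {set word w}}) h :
    P \subset F -> Q \subset F ->
    (forall p, p \in setX P Q -> exists t, hist p t = h) ->
  \sum_(p in X :&: setX P Q | ~~ is_probe (query A (iter T (step p) h)))
    ((2 ^ w)%:R^-1 : R) ^+ size (iter T (step p) h)
  <= L%:R * (2 ^ w)%:R^-1 ^+ size h.
Proof.
set q : R := _^-1; have q0 : 0 <= q by rewrite invr_ge0.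
elim: T => [|T IHT] in P Q h *; move=> PF QF Hh; case Eh: (query A h) => [i a|y].
- rewrite big_pred0; first by rewrite mulr_ge0 ?exprn_ge0.
  by move=> p; rewrite /= andbF.
(* All inputs of the rectangle reach [h], hence share the answer [y], and at most [L] of them lie in
   [X]. *)
- apply: le_trans (_ : \sum_(p in X :&: setX P Q) q ^+ size h <= _).
    rewrite big_mkcondr /=; exact: ler_sum.
  rewrite sumr_const -[X in X <= _]mulr_natl ler_wpM2r ?exprn_ge0// ler_nat.
  apply: (rectangle_le (y := y)) => // p /Hh[t ht]; exists t.
  by move: ht; rewrite /hist => ->.
- pose v (p : {set word w} * {set word w}) := represent A i (two_sets c p.1 p.2 i) a.
  rewrite (partition_big v predT)//=.
  apply: le_trans (_ : \sum_(x : word w) L%:R * q ^+ (size h).+1 <= _); last first.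
    have qq : (2 ^ w)%:R * q = 1 by rewrite divff// pnatr_eq0 -lt0n expn_gt0.
    rewrite sumr_const card_tuple card_bool -[X in X <= _]mulr_natl exprS.
    by rewrite mulrCA [X in L%:R * X <= _]mulrA qq mul1r.
  apply: ler_sum => x _.
  (* The probed set equals only one of the two sets, so the content of the cell splits only one side
     and the parts are again rectangles. *)
  pose P' := if c i then [set s in P | represent A i s a == x] else P.
  pose Q' := if c i then Q else [set s in Q | represent A i s a == x].
  have PQ' p : (p \in setX P' Q') = (p \in setX P Q) && (v p == x).
    case: p => s1 s2; rewrite /P' /Q' /v /two_sets /= !in_setX.
    case: (c i); rewrite !inE /=.
      by rewrite andbAC.
    by rewrite andbA.
  have IH : \sum_(p in X :&: setX P' Q' |
        ~~ is_probe (query A (iter T (step p) (rcons h x))))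
      q ^+ size (iter T (step p) (rcons h x)) <= L%:R * q ^+ (size h).+1.
    rewrite -(size_rcons h x); apply: IHT.
    - by rewrite /P'; case: (c i) => //; apply: subset_trans PF; apply/subsetP => s;
        rewrite inE => /andP[].
    - by rewrite /Q'; case: (c i) => //; apply: subset_trans QF; apply/subsetP => s;
        rewrite inE => /andP[].
    - move=> p; rewrite PQ' => /andP[/Hh[t ht] /eqP vp]; exists t.+1.
      by move: ht; rewrite /hist /= => ->; rewrite Eh -vp.
  apply: le_trans IH; rewrite le_eqVlt; apply/orP; left; apply/eqP.
  have stepE p : v p = x -> step p h = rcons h x.
    by rewrite /step Eh /v => ->.
  apply: eq_big => p.
    rewrite !in_setI PQ'; have [/stepE|] := eqVneq (v p) x.
      by rewrite -iterS iterSr => ->; rewrite !andbT.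
    by rewrite !andbF.
  by move=> /andP[_ /eqP /stepE]; rewrite -iterS iterSr => ->.
- apply: le_trans (_ : \sum_(p in X :&: setX P Q) q ^+ size h <= _).
    rewrite big_mkcondr /=; apply: ler_sum => p _.
    have -> : step p (iter T (step p) h) = h.
      by elim: T {IHT} => [|T' IH] /=; rewrite ?IH /step Eh.
    by rewrite /= Eh.
  rewrite sumr_const -[X in X <= _]mulr_natl ler_wpM2r ?exprn_ge0// ler_nat.
  apply: (rectangle_le (y := y)) => // p /Hh[t ht]; exists t.
  by move: ht; rewrite /hist => ->.
Qed.

Hypothesis XF : X \subset setX F F.

Hypothesis Xanswer : forall p, p \in X ->
  exists y, outputs A (two_sets c p.1 p.2) y.

(** Kraft's inequality bounds the sum over [X] of 2^(-w n_p) by [L], where n_p counts the probes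
    read on p. Applying 1 + u <= exp u to u = ln (#|X| / L) - n_p w ln 2 shows that these u sum to
    at most 0. *)
Lemma sum_probes_ge (R : realType) : (0 < w)%N -> (0 < L)%N -> (0 < #|X|)%N ->
  ((#|X|%:R * (ln (#|X|%:R / L%:R) / (w%:R * ln 2)) : R)%:E <=
   \sum_(p in X) probes R A (two_sets c p.1 p.2))%E.
Proof.
move=> w0 L0 X0.
have [t Ht] : exists t : {set word w} * {set word w} -> nat,
    forall p, p \in X -> ~~ is_probe (query A (hist p (t p))).
  apply: (@fin_all_exists _ (fun=> nat)
    (fun p t => p \in X -> ~~ is_probe (query A (hist p t)))) => p.
  have [/Xanswer[y [t Ht]]|] := boolP (p \in X); last by exists 0.
  by exists t; rewrite /hist Ht.
(* By time [T] the algorithm has answered on every input of [X]. *)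
pose T := \max_p t p.
have HT p : p \in X -> ~~ is_probe (query A (hist p T)).
  move=> /Ht; case E: (query _ _) => [|y] // _.
  by rewrite /hist (history_answer (leq_bigmax p) E) -/(hist _ _) E.
pose n p := size (hist p T).
have kraft : \sum_(p in X) ((2 ^ w)%:R^-1 : R) ^+ n p <= L%:R.
  have := @rectangle_kraft R T F F [::] (subxx _) (subxx _) (fun p _ => ex_intro _ 0%N erefl).
  rewrite expr0 mulr1; apply: le_trans; rewrite le_eqVlt; apply/orP; left.
  apply/eqP; apply: eq_big => p.
    rewrite (setIidPl XF); case pX: (p \in X) => //=.
    by have := HT _ pX; rewrite /hist history_iter => ->.
  by move=> pX; rewrite /n /hist history_iter.
apply: le_trans (_ : (\sum_(p in X) (n p)%:R%:E <= _)%E); last first.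
  by apply: lee_sum => p _; exact: probes_ge_size.
rewrite sumEFin lee_fin.
have L0' : 0 < L%:R :> R by rewrite ltr0n.
have X0' : 0 < #|X|%:R :> R by rewrite ltr0n.
have ln20 : 0 < ln 2 :> R by rewrite ln_gt0// ltr1n.
have wl0 : 0 < w%:R * ln 2 :> R by rewrite mulr_gt0// ltr0n.
set b : R := ln (#|X|%:R / L%:R).
have tangent p : (#|X|%:R / L%:R) * ((2 ^ w)%:R^-1 : R) ^+ n p >=
    1 + (b - (n p)%:R * (w%:R * ln 2)).
  apply: le_trans (expR_ge1Dx _) _; rewrite expRD lnK ?posrE ?divr_gt0//.
  rewrite ler_pM2l ?divr_gt0// expRN expRM_natl.
  rewrite natrX exprVn lef_pV2 ?posrE ?exprn_gt0 ?expR_gt0 ?ltr0n//.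
  by rewrite expRM_natl lnK// posrE ltr0n.
have : \sum_(p in X) (1 + (b - (n p)%:R * (w%:R * ln 2))) <= #|X|%:R.
  apply: le_trans (_ : \sum_(p in X) (#|X|%:R / L%:R) * ((2 ^ w)%:R^-1 : R) ^+ n p <= _).
    by apply: ler_sum => p _; exact: tangent.
  rewrite -mulr_sumr mulrAC ler_pdivrMr// ler_pM2l//.
rewrite big_split /= sumr_const sumrB sumr_const -mulr_suml.
rewrite gerDl subr_le0 -[X in X <= _]mulr_natl => H.
by rewrite mulrA ler_pdivrMr.
Qed.

End Rectangles.

Lemma exists_ge_average (R : realType) (I : finType) (X : {set I})
    (f : I -> \bar R) (b : R) :
    (0 < #|X|)%N -> (forall i, (0 <= f i)%E) ->
    ((#|X|%:R * b)%:E <= \sum_(i in X) f i)%E ->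
  exists2 i, i \in X & (b%:E <= f i)%E.
Proof.
move=> X0 f0 Hsum; apply: contrapT => nex.
have lt_fb i : i \in X -> (f i < b%:E)%E.
  by move=> iX; rewrite ltNge; apply/negP => bi; apply: nex; exists i.
(* Values below [b] are finite, which moves the comparison of sums to the reals. *)
have fin i : i \in X -> f i = (fine (f i))%:E.
  move=> iX; rewrite fineK// ge0_fin_numE//.
  by apply: lt_trans (lt_fb i iX) _; rewrite ltry.
move: Hsum; rewrite (eq_bigr (fun i => (fine (f i))%:E)) ?sumEFin ?lee_fin; last first.
  by move=> i; exact: fin.
apply/negP; rewrite -ltNge mulr_natl -sumr_const.
have [i0 i0X] : exists i, i \in X by apply/set0Pn; rewrite -card_gt0.
apply: ltr_sum; first by apply/hasP; exists i0 => //; rewrite mem_index_enum.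
by move=> i iX; rewrite -lte_fin -fin// lt_fb.
Qed.

(** * Averaging over the randomness *)

Section Randomized.
Variables (R : realType) (d : measure_display) (T : measurableType d).
Variables (P : probability T R) (w m : nat) (A : T -> scheme w m).
Variables (e : ui_tree m) (c : 'I_m -> bool) (n k : nat).
Hypothesis cP : forall (U : finType) (a b : {set U}),
  ui_eval (two_sets c a b) e = a :&: b.
Hypothesis AP : computes_card P A e n k.

Variables (F : {set {set word w}}) (X : {set {set word w} * {set word w}}).
Variable L : nat.
Hypothesis Fsmall : forall a, a \in F -> (m * #|a| <= n)%N.
Hypothesis XF : X \subset setX F F.
Hypothesis Xk : forall p, p \in X -> (#|p.1 :&: p.2| <= k)%N.
(** A purely combinatorial condition, free of the scheme. It constrains only pairs under the promise
    [#|a :&: b| <= k], since elsewhere the algorithm may answer anything. *)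
Hypothesis rectangle_le : forall (V W : {set {set word w}}) y,
  V \subset F -> W \subset F ->
  (forall a b, a \in V -> b \in W -> (#|a :&: b| <= k)%N -> #|a :&: b| = y) ->
  (#|X :&: setX V W| <= L)%N.

Lemma two_sets_admissible a b : a \in F -> b \in F -> (#|a :&: b| <= k)%N ->
  admissible e n k (two_sets c a b).
Proof.
move=> /Fsmall am /Fsmall bm abk; split; last by rewrite cP.
(* How many leaves get each colour is unknown, so every leaf is charged the larger size. *)
apply: leq_trans (_ : m * maxn #|a| #|b| <= n)%N; last first.
  by rewrite /maxn; case: ifP.
rewrite -[X in (_ <= X * _)%N](card_ord m) -sum_nat_const.
by apply: leq_sum => i _; rewrite /two_sets; case: (c i);
  rewrite ?leq_maxl ?leq_maxr.
Qed.

(** Yao's principle: the expected times summed over [X] are the expectation of the sum, which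
    [sum_probes_ge] bounds for almost every outcome. *)
Lemma expected_time_ge : (0 < w)%N -> (0 < L)%N -> (0 < #|X|)%N ->
  exists2 S, admissible e n k S &
    ((ln (#|X|%:R / L%:R : R) / (w%:R * ln 2))%:E <= expected_time P A S)%E.
Proof.
move=> w0 L0 X0; set b : R := ln _ / _.
have Xadm p : p \in X -> admissible e n k (two_sets c p.1 p.2).
  move=> pX; have := subsetP XF _ pX; rewrite inE => /andP[p1 p2].
  by apply: two_sets_admissible => //; exact: Xk.
(* A negative bound holds on any input; the comparison of integrals below is between nonnegative
   functions. *)
have [b0|/ltW b0] := leP 0 b; last first.
  have [p pX] : exists p, p \in X by apply/set0Pn; rewrite -card_gt0.
  exists (two_sets c p.1 p.2); first exact: Xadm.
  apply: (@le_trans _ _ 0%E); first by rewrite lee_fin.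
  by apply: integral_ge0 => x _; exact: probes_ge0.
(* Extended by zero outside [X], as measurability is known only on admissible inputs. *)
pose g p x : \bar R :=
  if p \in X then probes R (A x) (two_sets c p.1 p.2) else 0%E.
have mg p : measurable_fun [set: T]%classic (g p).
  rewrite /g; case pX: (p \in X); last exact: measurable_cst.
  exact: (AP (Xadm _ pX)).1.
have g0 p x : (0 <= g p x)%E by rewrite /g; case: ifP => // _; exact: probes_ge0.
have [p pX Hp] : exists2 p, p \in X & (b%:E <= \int[P]_x g p x)%E.
  apply: exists_ge_average => // [p|]; first exact: integral_ge0.
  rewrite -big_enum /= -ge0_integral_sum//.
  have -> : (#|X|%:R * b)%:E = (\int[P]_x (#|X|%:R * b)%:E)%E.
    rewrite (integral_cst P measurableT) -[LHS]mule1.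
    by congr (_ * _)%E; exact: (esym (probability_setT P)).
  apply: ae_ge0_le_integral => //.
  - by move=> x _; rewrite lee_fin mulr_ge0.
  - by move=> x _; apply: sume_ge0.
  - exact: emeasurable_sum.
  (* There are finitely many pairs, so one null set serves for all. Pairs outside [X] are included
     because answer rectangles may leave [X]. *)
  have Pcorrect : {ae P, forall x, forall p : {set word w} * {set word w},
      p \in setX F F /\ (#|p.1 :&: p.2| <= k)%N ->
      outputs (A x) (two_sets c p.1 p.2) #|p.1 :&: p.2| }.
    apply: (@filter_forall _ _ _ _ (ae_filter_ringOfSetsType P)) => p.
    have [[]|np] := pselect (p \in setX F F /\ (#|p.1 :&: p.2| <= k)%N).
      rewrite inE => /andP[p1 p2] pk.
      have := (AP (two_sets_admissible p1 p2 pk)).2; rewrite cP.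
      by apply: (@filterS _ _ (ae_filter_ringOfSetsType P)) => x.
    by apply: (@aeW _ _ _ P) => x.
  apply: (@filterS _ _ (ae_filter_ringOfSetsType P) _ _ _ Pcorrect) => x Ax _.
  rewrite big_enum /=.
  apply: le_trans (_ : \sum_(p in X) probes R (A x) (two_sets c p.1 p.2) <= _)%E; last first.
    by apply: lee_sum => p pX; rewrite /g pX.
  apply: (@sum_probes_ge _ _ _ _ F) => //.
    move=> V W y VF WF VWy; apply: (rectangle_le (y := y)) => // a b' aV bW abk.
    apply: outputs_uniq (VWy (a, b') _); last by rewrite in_setX aV.
    by apply: (Ax (a, b')); rewrite in_setX (subsetP VF) ?(subsetP WF).
  move=> p pX; exists #|p.1 :&: p.2|; apply: Ax; split; last exact: Xk.
  exact: (subsetP XF).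
exists (two_sets c p.1 p.2); first exact: Xadm.
by move: Hp; rewrite /g pX.
Qed.
End Randomized.

(** * The two hard families of inputs *)

Section TwoBounds.
Variables (R : realType) (d : measure_display) (T : measurableType d).
Variables (P : probability T R) (w m : nat) (A : T -> scheme w m).
Variables (e : ui_tree m) (c : 'I_m -> bool) (n k : nat).
Hypothesis cP : forall (U : finType) (a b : {set U}),
  ui_eval (two_sets c a b) e = a :&: b.
Hypothesis AP : computes_card P A e n k.
Hypotheses (w0 : (0 < w)%N) (k0 : (0 < k)%N).

Lemma card_word : #|word w| = (2 ^ w)%N.
Proof. by rewrite card_tuple card_bool. Qed.

(** A rectangle that contains a disjoint pair has answer 0. As 0 < k, pairs with exactly one common
    element are under the promise and would have answer 1, so [card_disjoint_pairs_le] applies. *)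
Lemma disjointness_bound (N : nat) : (m * N <= n)%N -> (N <= 2 ^ w)%N ->
  exists2 S, admissible e n k S &
    ((N%:R / (2 * w%:R) : R)%:E <= expected_time P A S)%E.
Proof.
move=> mN N2.
have [V cV] : exists V : {set word w}, #|V| = N.
  have : (0 < #|[set V : {set word w} | #|V| == N]|)%N.
    by rewrite card_draws card_word bin_gt0.
  by case/card_gt0P => V; rewrite inE => /eqP; exists V.
pose F := powerset V; pose X := disjoint_pairs (word w) :&: setX F F.
have X3 : (3 ^ N <= #|X|)%N by rewrite -cV; exact: card_disjoint_pairs_powerset.
have X0 : (0 < #|X|)%N by apply: leq_trans X3; rewrite expn_gt0.
have [|||||S HS ES] := @expected_time_ge R _ _ P w m A e c n k cP AP F X (2 ^ N) _ _ _ _ w0 _ X0.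
- move=> a; rewrite inE => /subset_leq_card; rewrite cV => aN.
  by apply: leq_trans mN; rewrite leq_mul2l aN orbT.
- exact: subsetIr.
- by move=> p; rewrite !inE -setI_eq0 => /andP[/eqP -> _]; rewrite cards0.
- move=> V' W' y VF WF VWy.
  have [->|[[a b]]] := set_0Vmem (X :&: setX V' W'); first by rewrite cards0.
  rewrite inE in_setX 2!inE -setI_eq0 /= => /andP[/andP[/eqP ab0 _] /andP[aV bW]].
  have y0 : y = 0%N by rewrite -(VWy a b)// ab0 cards0.
  rewrite -cV; apply: leq_trans (_ : #|disjoint_pairs (word w) :&: setX V' W'| <= _)%N.
    by apply/subset_leq_card/setSI/subsetIl.
  apply: card_disjoint_pairs_le.
  + by move=> s /(subsetP VF); rewrite inE.
  + by move=> s /(subsetP WF); rewrite inE.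
  + move=> s t sV tW; apply/eqP => st1.
    by have := VWy _ _ sV tW; rewrite st1 y0 => /(_ k0).
- by rewrite expn_gt0.
exists S => //; apply: le_trans ES; rewrite lee_fin.
have ln20 : 0 < ln 2 :> R by rewrite ln_gt0// ltr1n.
have w0' : 0 < w%:R :> R by rewrite ltr0n.
rewrite ler_pdivlMr ?mulr_gt0//.
have -> : N%:R / (2 * w%:R) * (w%:R * ln 2) = N%:R * (ln 2 / 2) :> R.
  by rewrite invfM; field; rewrite lt0r_neq0.
apply: le_trans (_ : ln ((3 / 2 : R) ^+ N) <= _); last first.
  rewrite ler_ln ?posrE ?exprn_gt0 ?divr_gt0 ?ltr0n ?expn_gt0//.
  by rewrite expr_div_n !natrX ler_pM2r ?invr_gt0 ?exprn_gt0// -natrX ler_nat.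
rewrite lnXn ?divr_gt0// -[leRHS]mulr_natl ler_wpM2l//.
(* The factor 1/2 comes from 2 <= (3/2)^2, that is, ln 2 / 2 <= ln (3/2). *)
rewrite ler_pdivrMr// mulr_natr -lnXn ?divr_gt0//.
by rewrite ler_ln ?posrE ?exprn_gt0 ?divr_gt0// expr2; lra.
Qed.

(** If (a, a) and (b, b) lie in one answer rectangle, so does (a, b). The first pair forces the
    answer k, so a and b share k elements and are equal. *)
Lemma fooling_set_bound : (m * k <= n)%N -> (k <= 2 ^ w)%N ->
  exists2 S, admissible e n k S &
    (((1 - log2 (k%:R : R) / w%:R) * k%:R)%:E <= expected_time P A S)%E.
Proof.
move=> mk k2.
pose F := [set a : {set word w} | #|a| == k].
pose f (a : {set word w}) := (a, a); pose X := f @: F.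
have cX : #|X| = 'C(2 ^ w, k).
  by rewrite card_imset ?card_draws ?card_word// => a b [].
have X0 : (0 < #|X|)%N by rewrite cX bin_gt0.
have [|||||S HS ES] := @expected_time_ge R _ _ P w m A e c n k cP AP F X 1 _ _ _ _ w0 _ X0.
- by move=> a; rewrite inE => /eqP ->.
- by apply/subsetP => _ /imsetP[a aF ->]; rewrite in_setX aF.
- by move=> _ /imsetP[a + ->]; rewrite inE setIid /= => /eqP ->.
- move=> V W y VF WF VWy.
  apply/card_le1_eqP => p q.
  rewrite in_setI => /andP[/imsetP[a aF ->]]; rewrite inE /= => /andP[aV aW].
  rewrite in_setI => /andP[/imsetP[b bF ->]]; rewrite inE /= => /andP[bV bW].
  have /eqP ak : #|a| == k by rewrite inE in aF.
  have /eqP bk : #|b| == k by rewrite inE in bF.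
  have yk : y = k by rewrite -(VWy a a) ?setIid// ak.
  have abk : #|a :&: b| = k.
    by rewrite (VWy a b)//; rewrite -ak subset_leq_card// subsetIl.
  have /eqP aab : a :&: b == a by rewrite eqEcard subsetIl ak abk leqnn.
  have /eqP bab : a :&: b == b by rewrite eqEcard subsetIr bk abk leqnn.
  by rewrite (etrans (esym aab) bab).
- by [].
exists S => //; apply: le_trans ES; rewrite lee_fin cX divr1.
have ln20 : 0 < ln 2 :> R by rewrite ln_gt0// ltr1n.
have w0' : 0 < w%:R :> R by rewrite ltr0n.
have k0' : 0 < k%:R :> R by rewrite ltr0n.
rewrite ler_pdivlMr ?mulr_gt0//.
(* From q^k <= 'C(2^w, k), the logarithm is at least k (w ln 2 - ln k), which divided by w ln 2 is
   exactly the required term. *)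
pose q : R := (2 ^ w)%:R / k%:R.
have q0 : 0 < q by rewrite divr_gt0 ?ltr0n ?expn_gt0.
apply: le_trans (_ : ln (q ^+ k) <= _); last first.
  rewrite ler_ln ?posrE ?exprn_gt0 ?ltr0n ?bin_gt0//.
  apply: expr_le_bin; last by rewrite divfK ?lt0r_neq0.
  by rewrite ler_pdivlMr// mul1r ler_nat.
rewrite lnXn// /q lnM ?posrE ?invr_gt0 ?ltr0n ?expn_gt0// lnV ?posrE//.
rewrite natrX lnXn// -[leRHS]mulr_natl -(mulr_natl (ln 2) w) /log2 le_eqVlt; apply/orP; left; apply/eqP.
by field; rewrite !lt0r_neq0.
Qed.

End TwoBounds.

(** * Combining the two bounds *)

(** A lone leaf has only the empty path, which meets no intersection. This gives m >= 2, hence log2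
    m >= 1. *)
Lemma inter_on_every_path_gt1 (m : nat) (e : ui_tree m) :
  inter_on_every_path e -> (1 < size (leaves e))%N.
Proof.
have size_leaves_gt0 (t : ui_tree m) : (0 < size (leaves t))%N.
  by elim: t => //= _ l l0 r _; rewrite size_cat addn_gt0 l0.
by case: e => //= o l r _; rewrite size_cat -addn1 leq_add.
Qed.

Theorem theorem3 (R : realType) :
  exists2 c : R, 0 < c &
    forall (w m : nat) (e : ui_tree m) (n k : nat),
      (0 < w)%N ->
      ui_expression e ->
      inter_on_every_path e ->
      (0 < k)%N ->
      k%:R <= n%:R / m%:R :> R ->
      (n <= m * 2 ^ w)%N ->
      forall (d : measure_display) (T : measurableType d)
        (P : probability T R) (A : T -> scheme w m),
        computes_card P A e n k ->
        exists2 S : 'I_m -> {set word w}, admissible e n k S &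
          ((c * (n%:R / (w%:R * m%:R * log2 (m%:R : R))
                 + (1 - log2 (k%:R : R) / w%:R) * k%:R))%:E
             <= expected_time P A S)%E.
Proof.
(* With D = N / (2 w) the disjointness bound, x <= 4 D gives x + y <= 5 max(D, y), so any constant
   up to 1/5 works, on the input of the larger bound. *)
exists (1 / 8); first by lra.
move=> w m e n k w0 em ei k0 kn nm d T P A AP.
have m1 : (1 < m)%N.
  by have := inter_on_every_path_gt1 ei; rewrite (perm_size em) size_enum_ord.
have m0 : (0 < m)%N by exact: ltnW.
have [c cP] := two_coloring (etrans (perm_uniq em) (enum_uniq _)) ei.
have mk : (m * k <= n)%N.
  by move: kn; rewrite ler_pdivlMr ?ltr0n// -natrM ler_nat mulnC.
(* [nm] ensures that the universe holds sets of [k], and below of [N], words. *)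
have k2 : (k <= 2 ^ w)%N by rewrite -(leq_pmul2l m0); exact: leq_trans mk nm.
pose N := (n %/ m)%N.
have kN : (k <= N)%N by rewrite leq_divRL// mulnC.
have mN : (m * N <= n)%N by rewrite mulnC leq_divM.
have N2 : (N <= 2 ^ w)%N by rewrite -(leq_pmul2l m0); exact: leq_trans mN nm.
have [S1 HS1 ES1] := disjointness_bound cP AP w0 k0 mN N2.
have [S2 HS2 ES2] := fooling_set_bound cP AP w0 k0 mk k2.
have w0' : 0 < w%:R :> R by rewrite ltr0n.
have m0' : 0 < m%:R :> R by rewrite ltr0n.
have log2m : 1 <= log2 (m%:R : R).
  by rewrite ler_pdivlMr ?ln_gt0 ?ltr1n// mul1r ler_ln ?posrE ?ler_nat.
set x : R := n%:R / _; set y : R := (1 - _) * _ in ES2 *.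
(* Rounding costs a factor 2: n <= (N + 1) m <= 2 N m, because 1 <= k <= N. The factor log2 m >= 1
   is dropped. *)
have x_le : x <= 4 * (N%:R / (2 * w%:R)).
  rewrite /x ler_pdivrMr; last first.
    by rewrite (mulr_gt0 (mulr_gt0 _ _))// (lt_le_trans ltr01).
  have -> : 4 * (N%:R / (2 * w%:R)) * (w%:R * m%:R * log2 m%:R) =
      2 * N%:R * m%:R * log2 (m%:R : R).
    by field; rewrite lt0r_neq0.
  apply: le_trans (_ : 2 * N%:R * m%:R <= _); last first.
    by rewrite ler_peMr// !mulr_ge0.
  rewrite -!natrM ler_nat; apply: leq_trans (ltnW (ltn_ceil n m0)) _.
  by rewrite leq_mul2r -/N mul2n -addnn -addn1 leq_add2l (leq_trans k0 kN) orbT.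
have [yx|xy] := leP y (N%:R / (2 * w%:R)).
  exists S1 => //; apply: le_trans ES1; rewrite lee_fin.
  have : 0 <= N%:R / (2 * w%:R) :> R by rewrite divr_ge0 ?mulr_ge0.
  by lra.
exists S2 => //; apply: le_trans ES2; rewrite lee_fin.
have : 0 <= N%:R / (2 * w%:R) :> R by rewrite divr_ge0 ?mulr_ge0.
by lra.
Qed.
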